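(* Let $G=\mathrm{GL}_n(\mathbb{C})$, let $\Pi$ be a finitely generated discrete group, $\tilde\Pi\subset\Pi$ a finitely generated normal subgroup of finite index with quotient $\Gamma=\Pi/\tilde\Pi$, and $\psi:\Gamma\to\mathrm{Aut}\,G$ a homomorphism. For a semi-simple representation $\tilde\rho:\tilde\Pi\to G$ denote by $[\tilde\rho]\in \mathrm{Ch}(\tilde\Pi,G)$ its $G$-orbit. Then: (i) For each $[\tilde\rho]\in\mathrm{Ch}^{\circ}(\tilde\Pi,G)^{\Gamma}$, the element $\mathfrak{c}([\tilde\rho])\in H^2(\Gamma,Z_G)$ (defined in the context) is well-defined. This gives a partition of $\mathrm{Ch}^{\circ}(\tilde\Pi,G)^{\Gamma}$ indexed by elements of $H^2(\Gamma,Z_G)$. (ii) For $[\tilde\rho]\in\mathrm{Ch}^{\circ}(\tilde\Pi,G)^{\Gamma}$, the representation $\tilde\rho$ is the underlying $G$-representation of some admissible $G\rtimes_{\psi'}\Gamma$-representation of $\Pi$, for some $\psi'\in\mathrm{Hom}(\Gamma,\mathrm{Aut}\,G)$ with $\Omega(\psi')=\Omega(\psi)$, if and only if $\mathfrak{c}([\tilde\rho])^{-1}=\delta(\psi')$ for some $\psi'$ with $\Omega(\psi')=\Omega(\psi)$. In this case, the semi-direct product $G\rtimes\Gamma$ is the one defined by this $\psi'$.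
   Context: $\mathrm{Aut}\,G$ is the group of algebraic automorphisms of $G$, $Z_G$ the centre of $G$, $\mathrm{Inn}\,G=G/Z_G$, $\mathrm{Out}\,G=\mathrm{Aut}\,G/\mathrm{Inn}\,G$, and $\Omega(\psi)$ is the composite of $\psi$ with $\mathrm{Aut}\,G\to\mathrm{Out}\,G$. Write $\psi_\sigma=\psi(\sigma)$. $G\rtimes_\psi\Gamma$ is the semi-direct product defined by $\psi$. A homomorphism $\rho:\Pi\to G\rtimes_{\psi}\Gamma$ is admissible if its composite with $G\rtimes_\psi\Gamma\to\Gamma$ is the quotient map $\Pi\to\Gamma$; its restriction $\tilde\rho:\tilde\Pi\to G$ is the underlying $G$-representation. $\mathrm{Ch}(\tilde\Pi,G)$ is the categorical quotient of the affine variety $\mathrm{Hom}(\tilde\Pi,G)$ by conjugation of $G$; its points are the orbits of semi-simple representations. $\mathrm{Ch}^{\circ}(\tilde\Pi,G)$ is the open subvariety of irreducible representations. Fix a set-theoretic section $\sigma\mapsto\gamma_\sigma$ of $\Pi\to\Gamma$ with $\gamma_1=1$. For $\tilde\rho:\tilde\Pi\to G$ put ${}^{\sigma}\tilde\rho(\alpha)=\psi_\sigma(\tilde\rho(\gamma_\sigma^{-1}\alpha\gamma_\sigma))$. The rule $[\tilde\rho]\mapsto[{}^\sigma\tilde\rho]$ is an action of $\Gamma$ on $\mathrm{Ch}(\tilde\Pi,G)$ depending only on $\Omega(\psi)$, and $\mathrm{Ch}^\circ(\tilde\Pi,G)^\Gamma$ is the set of $\Gamma$-fixed points in $\mathrm{Ch}^\circ(\tilde\Pi,G)$.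 Definition of $\mathfrak c$: if $[\tilde\rho]\in\mathrm{Ch}^{\circ}(\tilde\Pi,G)^\Gamma$, choose $h_\sigma\in G$ ($\sigma\in\Gamma$) with $h_\sigma\tilde\rho(\alpha)h_\sigma^{-1}={}^\sigma\tilde\rho(\alpha)$ for all $\alpha\in\tilde\Pi$; put $g_{\sigma\tau}=\tilde\rho(\gamma_\sigma\gamma_\tau\gamma_{\sigma\tau}^{-1})$ and $k_{\sigma\tau}=h_{\sigma\tau}^{-1}\psi_\sigma(h_\tau)h_\sigma g_{\sigma\tau}$. Then $\mathfrak c([\tilde\rho])$ is the class of $(k_{\sigma\tau})$ in $H^2(\Gamma,Z_G)$, where $\Gamma$ acts on $Z_G$ through $\psi$. Well-definedness means that $(k_{\sigma\tau})$ is a $Z_G$-valued 2-cocycle whose class depends only on $[\tilde\rho]$ and not on the choice of representative $\tilde\rho$ or of $(h_\sigma)$. Two homomorphisms $\psi',\psi''$ with $\Omega(\psi')=\Omega(\psi'')=\Omega(\psi)$ are equivalent if $\psi''_\sigma=(\mathrm{ad}\,g)\psi'_\sigma(\mathrm{ad}\,g)^{-1}$ for some $g\in G$ and all $\sigma$, where $\mathrm{ad}\,g$ is conjugation by $g$. Equivalence classes are identified with the pointed set $H^1(\Gamma,\mathrm{Inn}\,G)$ (with $\Gamma$ acting on $\mathrm{Inn}\,G$ by conjugation by $\psi_\sigma$, base point $\psi$): the class of the cocycle $(x_\sigma)$ corresponds to $\psi'_\sigma=x_\sigma\psi_\sigma$. The map $\delta:H^1(\Gamma,\mathrm{Inn}\,G)\to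 H^2(\Gamma,Z_G)$ is the connecting map: if $\psi'_\sigma=(\mathrm{ad}\,x_\sigma)\psi_\sigma$ with $x_\sigma\in G$, then $\delta(\psi')$ is the class of $x_{\sigma\tau}^{-1}x_\sigma\psi_\sigma(x_\tau)$. *)

(* Defs.v *)
From HB Require Import structures.
From mathcomp Require Import all_boot all_order all_algebra.
From mathcomp Require Import complex.
From mathcomp Require Import boolp classical_sets cardinality reals.

Set Implicit Arguments.
Unset Strict Implicit.
Unset Printing Implicit Defensive.

Import GRing.Theory.

Local Open Scope group_scope.

Definition finitely_generated (A : groupType) : Prop :=
  exists s : seq A, forall H : groupClosed A, {subset s <= H} -> forall x, x \in H.

(* Normal subgroups; a boolean predicate is no restriction, classical logic
   being available. *)
Record nsubgroup (A : groupType) := NSubgroup {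
  ns_pred :> {pred A};
  ns_closed : group_closed ns_pred;
  ns_conj : forall x y, x \in ns_pred -> x ^ y \in ns_pred }.

Section SubgroupType.
Variables (A : groupType) (N : nsubgroup A).

Definition subgT := {x : A | x \in N}.
HB.instance Definition _ := SubChoice.on subgT.
HB.instance Definition _ :=
  @SubChoice_isSubGroup.Build A (fun x => x \in N) subgT (ns_closed N).

Lemma ns1 : 1 \in N. Proof. exact: (ns_closed N).1. Qed.
Lemma nsF x y : x \in N -> y \in N -> x / y \in N.
Proof. exact: (ns_closed N).2. Qed.
Lemma nsV x : x \in N -> x^-1 \in N.
Proof. by move=> Nx; rewrite -[x^-1]mul1g nsF ?ns1. Qed.
Lemma nsM x y : x \in N -> y \in N -> x * y \in N.
Proof. by move=> Nx Ny; rewrite -[y]invgK nsF ?nsV. Qed.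
Lemma ns_swap x y : x * y \in N -> y * x \in N.
Proof. by move=> /(@ns_conj _ N _ x); rewrite conjgE !mulgA mulVg mul1g. Qed.

Definition conj_subg (g : A) (a : subgT) : subgT :=
  exist _ (val a ^ g) (ns_conj g (valP a)).

Lemma conj_subgM g : {morph conj_subg g : x y / x * y}.
Proof. by move=> x y; apply: val_inj; apply: conjMg. Qed.

Lemma subgM (x y : subgT) : val (x * y) = val x * val y. Proof. by []. Qed.
Lemma subg1 : val (1 : subgT) = 1. Proof. by []. Qed.
Lemma subgV (x : subgT) : val x^-1 = (val x)^-1. Proof. by []. Qed.

End SubgroupType.

Section QuotientGroup.
Variables (A : groupType) (N : nsubgroup A).

Definition coset_rel : rel A := fun x y => x^-1 * y \in N.

Lemma coset_rel_refl : reflexive coset_rel.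
Proof. by move=> x; rewrite /coset_rel mulVg ns1. Qed.
Lemma coset_rel_sym : symmetric coset_rel.
Proof.
by move=> x y; apply/idP/idP => /nsV; rewrite /coset_rel invgM invgK.
Qed.
Lemma coset_rel_trans : transitive coset_rel.
Proof.
by move=> y x z xy yz; have := nsM xy yz; rewrite mulgA mulgK.
Qed.

Canonical coset_equiv :=
  EquivRel coset_rel coset_rel_refl coset_rel_sym coset_rel_trans.

Definition quotT := {eq_quot coset_equiv}%qT.
HB.instance Definition _ := Choice.on quotT.

Definition qmap (x : A) : quotT := (\pi_({eq_quot coset_equiv}) x)%qT.
Definition qrepr (q : quotT) : A := repr (q : {eq_quot coset_equiv}%qT).

Lemma qreprK q : qmap (qrepr q) = q. Proof. exact: reprK. Qed.

Lemma qmapP x y : qmap x = qmap y <-> x^-1 * y \in N.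
Proof.
by split=> [/eqmodP|h]; last apply/eqmodP.
Qed.

Lemma qmapP' x y : qmap x = qmap y <-> exists2 z, z \in N & x = z * y.
Proof.
rewrite qmapP; split=> [/nsV|[z Nz ->]].
  rewrite invgM invgK => /ns_swap Nxy; exists (x * y^-1) => //.
  by rewrite mulgVK.
by apply: ns_swap; rewrite invgM mulgA mulgV mul1g nsV.
Qed.

Definition quot_mul (p q : quotT) := qmap (qrepr p * qrepr q).
Definition quot_inv (p : quotT) := qmap (qrepr p)^-1.

Lemma quot_mulE x y : quot_mul (qmap x) (qmap y) = qmap (x * y).
Proof.
have /qmapP hx := qreprK (qmap x); have /qmapP hy := qreprK (qmap y).
apply/qmapP; have := nsM (ns_conj (qrepr (qmap y)) hx) hy.
by rewrite conjgE invgM !mulgA mulgK.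
Qed.

Lemma quot_invE x : quot_inv (qmap x) = qmap x^-1.
Proof.
by apply/qmapP; rewrite invgK; apply/ns_swap/qmapP; rewrite qreprK.
Qed.

Lemma quot_mulA : associative quot_mul.
Proof.
by move=> p q r; rewrite -[p]qreprK -[q]qreprK -[r]qreprK !quot_mulE mulgA.
Qed.
Lemma quot_mul1 : left_id (qmap 1) quot_mul.
Proof. by move=> p; rewrite -[p]qreprK quot_mulE mul1g. Qed.
Lemma quot_mulr1 : right_id (qmap 1) quot_mul.
Proof. by move=> p; rewrite -[p]qreprK quot_mulE mulg1. Qed.
Lemma quot_mulV : left_inverse (qmap 1) quot_inv quot_mul.
Proof. by move=> p; rewrite -[p]qreprK quot_invE quot_mulE mulVg. Qed.
Lemma quot_mulrV : right_inverse (qmap 1) quot_inv quot_mul.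
Proof. by move=> p; rewrite -[p]qreprK quot_invE quot_mulE mulgV. Qed.

HB.instance Definition _ := isGroup.Build quotT
  quot_mulA quot_mul1 quot_mulr1 quot_mulV quot_mulrV.

Lemma qmapM : {morph qmap : x y / x * y}.
Proof. by move=> x y; rewrite -quot_mulE. Qed.
HB.instance Definition _ := isMultiplicative.Build A quotT qmap qmapM.
Lemma qmapV x : qmap x^-1 = (qmap x)^-1.
Proof. by rewrite -quot_invE. Qed.

End QuotientGroup.

Record qsection (A : groupType) (N : nsubgroup A) := QSection {
  qsec :> quotT N -> A;
  qsecK : forall s, qmap N (qsec s) = s;
  qsec1 : qsec 1 = 1 }.

Section Defect.
Variables (A : groupType) (N : nsubgroup A) (gam : qsection N).

Lemma defect_in s t : gam s * gam t * (gam (s * t))^-1 \in N.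
Proof.
apply: ns_swap; apply/qmapP.
by rewrite qmapM !qsecK.
Qed.

Definition defect s t : subgT N :=
  exist (fun x => x \in N) _ (defect_in s t).

End Defect.

Record tgroup (T : groupType) := TGroup {
  tg_sort :> groupType;
  tact : T -> tg_sort -> tg_sort;
  tactM : forall s, {morph tact s : x y / x * y};
  tact1 : forall x, tact 1 x = x;
  tactA : forall s t x, tact (s * t) x = tact s (tact t x) }.

Section H1.
Variables (T : groupType) (A : tgroup T).

Lemma tact_1 s : tact s (1 : A) = 1.
Proof. by apply: (mulgI (tact s 1)); rewrite -tactM !mulg1. Qed.
Lemma tactV s (x : A) : tact s x^-1 = (tact s x)^-1.
Proof. by apply: (mulgI (tact s x)); rewrite -tactM !mulgV tact_1. Qed.

Definition cocycle1 (x : T -> A) : Prop :=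
  forall s t, x (s * t) = x s * tact s (x t).

Definition Z1 := {x : T -> A | `[< cocycle1 x >]}.
HB.instance Definition _ := Choice.on Z1.

Definition Z1_mk (x : T -> A) (e : cocycle1 x) : Z1 :=
  exist (fun x => `[< cocycle1 x >]) x (introT (asboolP _) e).

Definition cohomologous1 (x y : Z1) : Prop :=
  exists g : A, forall s, val y s = g^-1 * val x s * tact s g.
Definition cohomologous1b : rel Z1 := fun x y => `[< cohomologous1 x y >].

Lemma cohomologous1_refl : reflexive cohomologous1b.
Proof.
by move=> x; apply/asboolP; exists 1 => s; rewrite tact_1 invg1 mul1g mulg1.
Qed.
Lemma cohomologous1_symP x y : cohomologous1 x y -> cohomologous1 y x.
Proof.
case=> g e; exists g^-1 => s; rewrite e invgK tactV !mulgA mulgV mul1g.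
by rewrite mulgK.
Qed.
Lemma cohomologous1_sym : symmetric cohomologous1b.
Proof.
by move=> x y; apply/asboolP/asboolP; apply: cohomologous1_symP.
Qed.
Lemma cohomologous1_trans : transitive cohomologous1b.
Proof.
move=> y x z /asboolP[g e] /asboolP[h f]; apply/asboolP; exists (g * h) => s.
by rewrite f e tactM invgM !mulgA.
Qed.

Canonical cohomologous1_equiv := EquivRel cohomologous1b
  cohomologous1_refl cohomologous1_sym cohomologous1_trans.

Definition H1 := {eq_quot cohomologous1_equiv}%qT.
HB.instance Definition _ := Choice.on H1.
Definition h1class (x : Z1) : H1 := (\pi_({eq_quot cohomologous1_equiv}) x)%qT.
Definition h1repr (c : H1) : Z1 := repr (c : {eq_quot cohomologous1_equiv}%qT).

Lemma h1reprK c : h1class (h1repr c) = c. Proof. exact: reprK. Qed.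
Lemma h1classP x y : h1class x = h1class y <-> cohomologous1 x y.
Proof.
by split=> [/eqmodP/asboolP|h]; last by apply/eqmodP/asboolP.
Qed.

End H1.

Record tmodule (T : groupType) := TModule {
  tm_tgroup :> tgroup T;
  tm_mulC : forall x y : tm_tgroup, x * y = y * x }.

Section H2.
Variables (T : groupType) (M : tmodule T).

Definition cocycle2 (k : T -> T -> M) : Prop :=
  forall s t u, tact s (k t u) * k s (t * u) = k (s * t) u * k s t.

Definition Z2 := {k : T -> T -> M | `[< cocycle2 k >]}.
HB.instance Definition _ := Choice.on Z2.

Lemma Z2P (k : Z2) : cocycle2 (val k). Proof. exact/asboolP/(valP k). Qed.

Definition Z2_mk (k : T -> T -> M) (e : cocycle2 k) : Z2 :=
  exist (fun k => `[< cocycle2 k >]) k (introT (asboolP _) e).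

Let mulACA : @interchange M *%g *%g.
Proof.
by move=> a b c d; rewrite -!mulgA; congr (_ * _); rewrite !mulgA (tm_mulC b).
Qed.

Let Z2_ext (k l : Z2) : (forall s t, val k s t = val l s t) -> k = l.
Proof. by move=> e; apply: val_inj; do 2!apply: funext => ?. Qed.

Lemma cocycle2_1 : cocycle2 (fun _ _ => 1).
Proof. by move=> s t u; rewrite tact_1. Qed.
Lemma cocycle2_mul (k l : Z2) : cocycle2 (fun s t => val k s t * val l s t).
Proof. by move=> s t u; rewrite tactM mulACA !Z2P mulACA. Qed.
Lemma cocycle2_inv (k : Z2) : cocycle2 (fun s t => (val k s t)^-1).
Proof.
move=> s t u; rewrite tactV -!invgM; congr (_^-1).
by rewrite tm_mulC Z2P tm_mulC.
Qed.

Definition Z2_one := Z2_mk cocycle2_1.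
Definition Z2_mul k l := Z2_mk (cocycle2_mul k l).
Definition Z2_inv k := Z2_mk (cocycle2_inv k).

Let Z2_mulA : associative Z2_mul.
Proof. by move=> *; apply: Z2_ext => s t; apply: mulgA. Qed.
Let Z2_mul1 : left_id Z2_one Z2_mul.
Proof. by move=> *; apply: Z2_ext => s t; apply: mul1g. Qed.
Let Z2_mulr1 : right_id Z2_one Z2_mul.
Proof. by move=> *; apply: Z2_ext => s t; apply: mulg1. Qed.
Let Z2_mulV : left_inverse Z2_one Z2_inv Z2_mul.
Proof. by move=> *; apply: Z2_ext => s t; apply: mulVg. Qed.
Let Z2_mulrV : right_inverse Z2_one Z2_inv Z2_mul.
Proof. by move=> *; apply: Z2_ext => s t; apply: mulgV. Qed.

HB.instance Definition _ := isGroup.Build Z2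
  Z2_mulA Z2_mul1 Z2_mulr1 Z2_mulV Z2_mulrV.

Lemma Z2_mulC : @commutative Z2 _ *%g.
Proof. by move=> *; apply: Z2_ext => s t; apply: tm_mulC. Qed.

Definition coboundary2 (k : Z2) : Prop :=
  exists c : T -> M, forall s t,
    val k s t = tact s (c t) * (c (s * t))^-1 * c s.

Lemma coboundary2_closed : group_closed (fun k : Z2 => `[< coboundary2 k >]).
Proof.
split=> [|k l /asboolP[c e] /asboolP[d f]]; apply/asboolP.
  by exists (fun=> 1) => s t; rewrite tact_1 invg1 !mulg1.
exists (fun s => c s / d s) => s t.
have -> : val (k / l) s t = val k s t / val l s t by [].
rewrite e f tactM tactV !invgM !invgK.
rewrite (tm_mulC (d s)^-1) (tm_mulC (d (s * t))) mulACA; congr (_ * _).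
by rewrite mulACA (tm_mulC (d (s * t))).
Qed.

Lemma coboundary2_conj (k l : Z2) :
  k \in (fun k : Z2 => `[< coboundary2 k >]) ->
  k ^ l \in (fun k : Z2 => `[< coboundary2 k >]).
Proof. by rewrite conjgE Z2_mulC mulgK. Qed.

Definition B2 : nsubgroup Z2 := NSubgroup coboundary2_closed coboundary2_conj.

Definition H2 := quotT B2.
HB.instance Definition _ := Group.on H2.
Definition h2class (k : Z2) : H2 := qmap B2 k.

End H2.

Section GLn.
Variables (F : fieldType) (n : nat).

Definition GL := {A : 'M[F]_n | A \in unitmx}.
HB.instance Definition _ := Choice.on GL.

Definition GL_one : GL := exist (fun A => A \in unitmx) 1%:M%R (unitmx1 F n).

Lemma GL_mul_subproof (g h : GL) : (val g *m val h)%R \in unitmx.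
Proof. by rewrite unitmx_mul (valP g) (valP h). Qed.
Definition GL_mul (g h : GL) : GL :=
  exist (fun A => A \in unitmx) _ (GL_mul_subproof g h).

Lemma GL_inv_subproof (g : GL) : invmx (val g) \in unitmx.
Proof. by rewrite unitmx_inv (valP g). Qed.
Definition GL_inv (g : GL) : GL :=
  exist (fun A => A \in unitmx) _ (GL_inv_subproof g).

Let GL_mulA : associative GL_mul.
Proof. by move=> *; apply: val_inj; apply: mulmxA. Qed.
Let GL_mul1 : left_id GL_one GL_mul.
Proof. by move=> *; apply: val_inj; apply: mul1mx. Qed.
Let GL_mulr1 : right_id GL_one GL_mul.
Proof. by move=> *; apply: val_inj; apply: mulmx1. Qed.
Let GL_mulV : left_inverse GL_one GL_inv GL_mul.
Proof. by move=> g; apply: val_inj; apply: mulVmx (valP g). Qed.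
Let GL_mulrV : right_inverse GL_one GL_inv GL_mul.
Proof. by move=> g; apply: val_inj; apply: mulmxV (valP g). Qed.

HB.instance Definition _ := isGroup.Build GL
  GL_mulA GL_mul1 GL_mulr1 GL_mulV GL_mulrV.

(* The coordinate ring F[x_ij, 1/det], as an algebra of functions. *)
Inductive regular : (GL -> F) -> Prop :=
| regular_const c : regular (fun=> c)
| regular_entry i j : regular (fun g => val g i j)
| regular_detV : regular (fun g => (\det (val g))^-1%R)
| regular_add f1 f2 : regular f1 -> regular f2 ->
    regular (fun g => f1 g + f2 g)%R
| regular_mul f1 f2 : regular f1 -> regular f2 ->
    regular (fun g => f1 g * f2 g)%R.

Definition regular_map (phi : GL -> GL) : Prop :=
  forall f, regular f -> regular (f \o phi).

Record algAut := AlgAut {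
  aut_fun :> GL -> GL;
  aut_inv : GL -> GL;
  aut_funM : {morph aut_fun : x y / x * y};
  aut_funK : cancel aut_fun aut_inv;
  aut_invK : cancel aut_inv aut_fun;
  aut_regular : regular_map aut_fun;
  aut_inv_regular : regular_map aut_inv }.

HB.instance Definition _ := gen_eqMixin algAut.
HB.instance Definition _ := gen_choiceMixin algAut.

Lemma algAut_ext (p q : algAut) : p =1 q -> p = q.
Proof.
case: p => p p' pM pK p'K pr p'r; case: q => q q' qM qK q'K qr q'r /= e.
have epq : p = q by apply: funext.
have epq' : p' = q' by apply: funext => x; rewrite -{1}[x]q'K -e pK.
by subst; congr AlgAut; apply: Prop_irrelevance.
Qed.

Definition aut_one : algAut :=
  @AlgAut id id (fun _ _ => erefl) (fun _ => erefl) (fun _ => erefl)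
    (fun _ rf => rf) (fun _ rf => rf).

Lemma aut_mul_funM (p q : algAut) : {morph p \o q : x y / x * y}.
Proof. by move=> x y /=; rewrite !aut_funM. Qed.
Definition aut_mul (p q : algAut) : algAut :=
  @AlgAut (p \o q) (aut_inv q \o aut_inv p) (@aut_mul_funM p q)
    (can_comp (@aut_funK p) (@aut_funK q))
    (can_comp (@aut_invK q) (@aut_invK p))
    (fun f rf => @aut_regular q _ (@aut_regular p f rf))
    (fun f rf => @aut_inv_regular p _ (@aut_inv_regular q f rf)).

Lemma aut_inv_funM (p : algAut) : {morph aut_inv p : x y / x * y}.
Proof.
move=> x y; rewrite -{1}[x](aut_invK p) -{1}[y](aut_invK p) -aut_funM.
exact: aut_funK.
Qed.
Definition aut_V (p : algAut) : algAut :=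
  @AlgAut (aut_inv p) p (@aut_inv_funM p) (@aut_invK p) (@aut_funK p)
    (@aut_inv_regular p) (@aut_regular p).

Let aut_mulA : associative aut_mul.
Proof. by move=> *; apply: algAut_ext. Qed.
Let aut_mul1 : left_id aut_one aut_mul.
Proof. by move=> *; apply: algAut_ext. Qed.
Let aut_mulr1 : right_id aut_one aut_mul.
Proof. by move=> *; apply: algAut_ext. Qed.
Let aut_mulV : left_inverse aut_one aut_V aut_mul.
Proof. by move=> p; apply: algAut_ext => x /=; rewrite aut_funK. Qed.
Let aut_mulrV : right_inverse aut_one aut_V aut_mul.
Proof. by move=> p; apply: algAut_ext => x /=; rewrite aut_invK. Qed.

HB.instance Definition _ := isGroup.Build algAut
  aut_mulA aut_mul1 aut_mulr1 aut_mulV aut_mulrV.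

Lemma algAutM (p q : algAut) x : (p * q) x = p (q x). Proof. by []. Qed.
Lemma algAut1 x : (1 : algAut) x = x. Proof. by []. Qed.

Lemma aut_fun1 (p : algAut) : p 1 = 1.
Proof. by apply: (mulgI (p 1)); rewrite -aut_funM !mulg1. Qed.
Lemma aut_funV (p : algAut) x : p x^-1 = (p x)^-1.
Proof. by apply: (mulgI (p x)); rewrite -aut_funM !mulgV aut_fun1. Qed.

Lemma regular_sum (I : Type) (r : seq I) (f : I -> GL -> F) :
  (forall k, regular (f k)) -> regular (fun g => \sum_(k <- r) f k g)%R.
Proof.
move=> rf; elim: r => [|k r ih].
  under eq_fun do rewrite big_nil; exact: regular_const.
under eq_fun do rewrite big_cons; exact: regular_add.
Qed.

Lemma regular_conj (h : GL) : regular_map (fun x => h * x * h^-1).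
Proof.
move=> f; elim=> {f} [c|i j||f1 f2 _ r1 _ r2|f1 f2 _ r1 _ r2].
- exact: regular_const.
- have -> : (fun g : GL => val g i j) \o (fun x => h * x * h^-1) =
      (fun g => \sum_k (\sum_l val h i l * val g l k) * val (GL_inv h) k j)%R.
    by apply: funext => g /=; rewrite mxE; apply: eq_bigr => k _; rewrite mxE.
  apply: regular_sum => k; apply: regular_mul; last exact: regular_const.
  apply: regular_sum => l; apply: regular_mul; first exact: regular_const.
  exact: regular_entry.
- have -> : (fun g : GL => (\det (val g))^-1)%R \o (fun x => h * x * h^-1) =
      (fun g => (\det (val g))^-1)%R.
    apply: funext => g /=; rewrite !det_mulmx det_inv mulrAC mulrV ?mul1r //.
    exact: (valP h).
  exact: regular_detV.
- exact: regular_add.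
- exact: regular_mul.
Qed.

Lemma conjM (h : GL) : {morph (fun x => h * x * h^-1) : x y / x * y}.
Proof. by move=> x y; rewrite !mulgA mulgVK. Qed.
Lemma conjK (h : GL) :
  cancel (fun x => h * x * h^-1) (fun x => h^-1 * x * (h^-1)^-1).
Proof. by move=> x; rewrite invgK !mulgA mulVg mul1g mulgVK. Qed.
Lemma conjVK (h : GL) :
  cancel (fun x => h^-1 * x * (h^-1)^-1) (fun x => h * x * h^-1).
Proof. by move=> x; rewrite invgK !mulgA mulgV mul1g mulgK. Qed.

Definition ad (h : GL) : algAut :=
  @AlgAut (fun x => h * x * h^-1) (fun x => h^-1 * x * (h^-1)^-1)
    (@conjM h) (@conjK h) (@conjVK h) (@regular_conj h) (@regular_conj h^-1).

Lemma adM : {morph ad : x y / x * y}.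
Proof. by move=> x y; apply: algAut_ext => z /=; rewrite invgM !mulgA. Qed.
Lemma adV (x : GL) : ad x^-1 = (ad x)^-1.
Proof. by apply: algAut_ext => z /=; rewrite invgK. Qed.
Lemma ad_conj (h : GL) (p : algAut) : p * ad h * p^-1 = ad (p h).
Proof.
apply: algAut_ext => z; rewrite !algAutM /=.
by rewrite !aut_funM aut_funV [p (_ z)]aut_invK.
Qed.

Lemma center_closed : group_closed (fun z : GL => `[< forall x, z * x = x * z >]).
Proof.
split=> [|y z /asboolP cy /asboolP cz]; apply/asboolP => x.
  by rewrite mul1g mulg1.
apply: (mulIg z); rewrite -[x * _ * _]mulgA mulgVK -!mulgA -cz.
by rewrite (mulgA z^-1) mulVg mul1g cy.
Qed.
Lemma center_conj (z g : GL) :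
  z \in (fun z : GL => `[< forall x, z * x = x * z >]) ->
  z ^ g \in (fun z : GL => `[< forall x, z * x = x * z >]).
Proof. by move=> /asboolP cz; rewrite conjgE cz mulgA mulVg mul1g; apply/asboolP. Qed.

Definition center : nsubgroup GL := NSubgroup center_closed center_conj.

Lemma centerP z : reflect (forall x, z * x = x * z) (z \in center).
Proof. exact: asboolP. Qed.

Lemma ad_eq x y : ad x = ad y <-> x^-1 * y \in center.
Proof.
split=> [e|/centerP c].
  apply/centerP => z; have /= := congr1 (fun p : algAut => p z) e => exy.
  apply: (mulgI x); rewrite !mulgA mulgV mul1g; apply: (mulIg y^-1).
  by rewrite -exy mulgK.
apply: algAut_ext => z /=; have := congr1 (fun u : GL => x * u * y^-1) (c z).
by rewrite !mulgA mulgV mul1g mulgK.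
Qed.

(* Inn G, viewed inside Aut G; it is G / Z_G by [ad_eq]. *)
Lemma inner_closed : group_closed (fun p : algAut => `[< exists h, p = ad h >]).
Proof.
have ad1 : ad 1 = 1 by apply: algAut_ext => z /=; rewrite invg1 mul1g mulg1.
split=> [|p q /asboolP[g ->] /asboolP[h ->]]; apply/asboolP; first by exists 1.
exists (g / h); rewrite adM; congr (_ * _); apply: (mulgI (ad h)).
by rewrite mulgV -adM mulgV ad1.
Qed.
Lemma inner_conj (p q : algAut) :
  p \in (fun p : algAut => `[< exists h, p = ad h >]) ->
  p ^ q \in (fun p : algAut => `[< exists h, p = ad h >]).
Proof.
move=> /asboolP[h ->]; apply/asboolP; exists ((q^-1 : algAut) h).
by rewrite -ad_conj invgK conjgE mulgA.
Qed.

Definition inner : nsubgroup algAut := NSubgroup inner_closed inner_conj.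

Definition Out := quotT inner.

End GLn.

Section TwistedForms.
Variables (F : fieldType) (n : nat) (T : groupType).
Local Notation G := (GL F n).
Local Notation AutG := (algAut F n).
Local Notation Z := (center F n).

Implicit Type psi : {multiplicative T -> AutG}.

Lemma psiM psi s t x : psi (s * t) x = psi s (psi t x).
Proof. by rewrite gmulfM. Qed.
Lemma psi1 psi x : psi 1 x = x.
Proof.
have -> // : psi 1 = 1.
by apply: (mulgI (psi 1)); rewrite -gmulfM !mulg1.
Qed.

Lemma central_shuffle (a c u v p e : G) :
  (forall x, a * x = x * a) -> (forall x, c * x = x * c) ->
  a * (u * v) * (c * (p * e)) = u * v * p * (e * a * c).
Proof.
move=> ca cc; have ac x : x * a * c = a * c * x.
  by rewrite -(ca x) -mulgA -(cc x) mulgA.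
by rewrite ac ca -!mulgA; do 2!congr (_ * _); rewrite !mulgA -ac.
Qed.

Lemma aut_center (p : AutG) z : z \in Z -> p z \in Z.
Proof.
move=> /centerP cz; apply/centerP => x.
by rewrite -[x](aut_invK p) -!aut_funM cz.
Qed.

Section Coefficients.
Variable psi : {multiplicative T -> AutG}.

Definition center_act (s : T) (z : subgT Z) : subgT Z :=
  exist (fun z => z \in Z) (psi s (val z)) (aut_center (psi s) (valP z)).

Lemma center_actM s : {morph center_act s : x y / x * y}.
Proof. by move=> x y; apply: val_inj; apply: aut_funM. Qed.
Lemma center_act1 x : center_act 1 x = x.
Proof. by apply: val_inj; apply: psi1. Qed.
Lemma center_actA s t x : center_act (s * t) x = center_act s (center_act t x).
Proof. by apply: val_inj; apply: psiM. Qed.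
Lemma center_mulC (x y : subgT Z) : x * y = y * x.
Proof. by apply: val_inj; rewrite !subgM; apply/centerP/valP. Qed.

Definition centerM : tmodule T :=
  @TModule T (TGroup center_actM center_act1 center_actA) center_mulC.

(* Inn G = G / Z_G, with the action of T by conjugation by psi: since
   psi_s (ad x) psi_s^-1 = ad (psi_s x), it sends the class of x to that of
   psi_s x. *)
Definition inn_act (s : T) (q : quotT Z) : quotT Z := qmap Z (psi s (qrepr q)).

Lemma inn_actE s x : inn_act s (qmap Z x) = qmap Z (psi s x).
Proof.
apply/qmapP; rewrite -aut_funV -aut_funM; apply: aut_center.
by apply/qmapP; rewrite qreprK.
Qed.
Lemma inn_actM s : {morph inn_act s : x y / x * y}.
Proof.
move=> p q; rewrite -[p]qreprK -[q]qreprK -qmapM !inn_actE -qmapM.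
by rewrite aut_funM.
Qed.
Lemma inn_act1 q : inn_act 1 q = q.
Proof. by rewrite -[q]qreprK inn_actE psi1. Qed.
Lemma inn_actA s t q : inn_act (s * t) q = inn_act s (inn_act t q).
Proof. by rewrite -[q]qreprK !inn_actE psiM. Qed.

Definition Inn : tgroup T := TGroup inn_actM inn_act1 inn_actA.

Definition lifts (x : T -> G) (c : Z1 Inn) : Prop :=
  forall s, qmap Z (x s) = val c s.

Definition represents (k : T -> T -> G) (z : Z2 centerM) : Prop :=
  forall s t, val (val z s t) = k s t.

Definition delta_cochain (x : T -> G) (s t : T) : G :=
  (x (s * t))^-1 * x s * psi s (x t).

Lemma delta_cochain_center x c s t : lifts x c -> delta_cochain x s t \in Z.
Proof.
move=> xc; rewrite /delta_cochain -mulgA; apply/qmapP.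
by rewrite qmapM -inn_actE !xc; apply: (asboolW (valP c)).
Qed.

Lemma delta_cochain_cocycle x c (xc : lifts x c) :
  cocycle2 (M := centerM) (fun s t =>
    exist (fun z => z \in Z) _ (delta_cochain_center s t xc)).
Proof.
move=> s t u; apply: val_inj => /=; rewrite /delta_cochain.
set d := fun s t => (x (s * t))^-1 * x s * psi s (x t).
have dE a b : x a * psi a (x b) = x (a * b) * d a b.
  by rewrite /d !mulgA mulgV mul1g.
have cd a b : d a b \in Z by exact: delta_cochain_center xc.
change (psi s (d t u) * d s (t * u) = d (s * t) u * d s t).
apply: (mulgI (x (s * (t * u)))); transitivity (x s * psi s (x t * psi t (x u))).
  have /centerP -> := aut_center (psi s) (cd t u).
  by rewrite [LHS]mulgA -dE -mulgA -aut_funM -dE.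
rewrite [s * (t * u)]mulgA [RHS]mulgA -dE -[RHS]mulgA; have /centerP <- := cd s t.
by rewrite [RHS]mulgA -dE psiM aut_funM !mulgA.
Qed.

Definition delta_cocycle (c : Z1 Inn) : Z2 centerM :=
  @Z2_mk _ centerM _
    (@delta_cochain_cocycle (fun s => qrepr (val c s)) c (fun s => qreprK _)).

(* The connecting map, computed on chosen representatives; [deltaE] shows that
   neither the cocycle nor the lifts matter. *)
Definition delta (c : H1 Inn) : H2 centerM :=
  h2class (delta_cocycle (h1repr c)).

Lemma deltaE (x : T -> G) (c : Z1 Inn) (z : Z2 centerM) :
  lifts x c -> represents (delta_cochain x) z -> delta (h1class c) = h2class z.
Proof.
move=> xc xz; have /h1classP[q qE] := h1reprK (h1class c).
set r := h1repr _ in qE; pose g := qrepr q; pose y s := qrepr (val r s).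
pose w s := g^-1 * y s * psi s g.
have wc : lifts w c.
  move=> s; rewrite /w !qmapM -inn_actE !qreprK qE.
  by congr (_ * _ * _); rewrite -[q in RHS]qreprK.
have yr : lifts y r by move=> s; apply: qreprK.
have wy s t : delta_cochain w s t = delta_cochain y s t.
  have /centerP cy := delta_cochain_center s t yr.
  rewrite -[RHS](mulKg (psi (s * t) g)) -cy /delta_cochain /w psiM.
  by rewrite !aut_funM aut_funV !invgM invgK !mulgA !(mulgK, mulgVK).
have zin s : (w s)^-1 * x s \in Z by apply/qmapP; rewrite wc xc.
pose zeta s : subgT Z := exist (fun z => z \in Z) _ (zin s).
have xE s : x s = w s * val (zeta s) by rewrite mulgA mulgV mul1g.
apply/qmapP/asboolP; exists (zeta : T -> centerM) => s t; apply: val_inj.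
change ((delta_cochain y s t)^-1 * val (val z s t) =
  psi s (val (zeta t)) * (val (zeta (s * t)))^-1 * val (zeta s)).
rewrite xz -wy; apply: (mulgI (delta_cochain w s t)); rewrite mulgA mulgV mul1g.
have /centerP c1 := valP (zeta s).
have /centerP c2 := nsV (valP (zeta (s * t))).
rewrite /delta_cochain !xE aut_funM invgM [LHS](_ : _ =
  (val (zeta (s * t)))^-1 * ((w (s * t))^-1 * w s) *
    (val (zeta s) * (psi s (w t) * psi s (val (zeta t))))); last first.
  by rewrite !mulgA.
exact: central_shuffle.
Qed.

End Coefficients.

Definition Omega psi : T -> Out F n := qmap (inner F n) \o psi.

Section FormClass.
Variables (psi psi' : {multiplicative T -> AutG}).
Hypothesis eOmega : Omega psi' = Omega psi.

Lemma form_lift s : {x : G | psi' s = ad x * psi s}.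
Proof.
apply: cid; have := congr1 (fun f => f s) eOmega.
by move=> /qmapP'[p /asboolP[x ->] e]; exists x.
Qed.

Definition form_cochain s : quotT Z := qmap Z (sval (form_lift s)).

Lemma form_cochainP (x : T -> G) :
  (forall s, psi' s = ad (x s) * psi s) -> forall s, form_cochain s = qmap Z (x s).
Proof.
move=> xP s; apply/qmapP/ad_eq; case: (form_lift s) => y /= e.
by apply: (mulIg (psi s)); rewrite -e xP.
Qed.

Lemma form_cocycle1 : cocycle1 (A := Inn psi) form_cochain.
Proof.
move=> s t; change (form_cochain (s * t) =
  form_cochain s * inn_act psi s (form_cochain t)).
rewrite inn_actE -qmapM; apply/qmapP/ad_eq.
apply: (mulIg (psi (s * t))); case: (form_lift (s * t)) => y /= <-.
case: (form_lift s) (form_lift t) => u /= eu [v /= ev].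
by rewrite gmulfM eu ev adM -ad_conj gmulfM !mulgA mulgVK.
Qed.

(* The class in H^1(T, Inn G) of the cocycle (x_s) with psi'_s = x_s psi_s;
   by [form_classP] it determines psi' up to conjugation by some ad g. *)
Definition form_class : H1 (Inn psi) :=
  h1class (@Z1_mk T (Inn psi) form_cochain form_cocycle1).

End FormClass.

Lemma form_classP (psi p q : {multiplicative T -> AutG})
    (ep : Omega p = Omega psi) (eq : Omega q = Omega psi) :
  form_class ep = form_class eq <->
  exists g, forall s, q s = ad g * p s * (ad g)^-1.
Proof.
have key (f : {multiplicative T -> AutG}) (ef : Omega f = Omega psi) s :
    exists2 x, f s = ad x * psi s & form_cochain ef s = qmap Z x.
  by rewrite /form_cochain; case: (form_lift ef s) => x /= e; exists x.
rewrite h1classP; split=> [[c cE]|[g gE]].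
  pose g := qrepr (c : quotT Z); exists g^-1 => s.
  have {cE} := cE s; change (form_cochain eq s =
    c^-1 * form_cochain ep s * inn_act psi s c -> q s = ad g^-1 * p s / ad g^-1).
  have [x -> ->] := key p ep s; have [y -> ->] := key q eq s.
  rewrite -[c]qreprK -/g inn_actE -qmapV -(qmapM Z g^-1) -(qmapM Z (g^-1 * x)).
  move=> /qmapP/ad_eq ->.
  rewrite !adM -ad_conj -[(ad g^-1)^-1]adV invgK.
  by rewrite !mulgA mulgVK.
exists (qmap Z g^-1 : Inn psi) => s; change (form_cochain eq s =
  (qmap Z g^-1)^-1 * form_cochain ep s * inn_act psi s (qmap Z g^-1)).
have [x ex ->] := key p ep s; have [y ey ->] := key q eq s.
rewrite inn_actE -qmapV invgK -(qmapM Z g) -(qmapM Z (g * x)).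
apply/qmapP/ad_eq.
apply: (mulIg (psi s)); rewrite -ey gE ex !adM -ad_conj adV !mulgA.
by rewrite mulgVK.
Qed.

End TwistedForms.

Section SemidirectProduct.
Variables (F : fieldType) (n : nat) (T : groupType).
Variable psi : {multiplicative T -> algAut F n}.
Local Notation G := (GL F n).

Definition sdprod (p : {multiplicative T -> algAut F n}) : Type := (G * T)%type.
Local Notation S := (sdprod psi).
HB.instance Definition _ p := Choice.on (sdprod p).

Definition sd_one : S := (1, 1).
Definition sd_mul (a b : S) : S := (a.1 * psi a.2 b.1, a.2 * b.2).
Definition sd_inv (a : S) : S := (psi a.2^-1 a.1^-1, a.2^-1).

Let sd_mulA : associative sd_mul.
Proof. by move=> a b c; rewrite /sd_mul /= aut_funM psiM !mulgA. Qed.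
Let sd_mul1 : left_id sd_one sd_mul.
Proof. by case=> g s; rewrite /sd_mul /= psi1 !mul1g. Qed.
Let sd_mulr1 : right_id sd_one sd_mul.
Proof. by case=> g s; rewrite /sd_mul /= aut_fun1 !mulg1. Qed.
Let sd_mulV : left_inverse sd_one sd_inv sd_mul.
Proof. by case=> g s; rewrite /sd_mul /= -aut_funM !mulVg aut_fun1. Qed.
Let sd_mulrV : right_inverse sd_one sd_inv sd_mul.
Proof. by case=> g s; rewrite /sd_mul /= -psiM !mulgV psi1 mulgV. Qed.

HB.instance Definition _ := isGroup.Build (sdprod psi)
  sd_mulA sd_mul1 sd_mulr1 sd_mulV sd_mulrV.

Lemma sdprodE (a b : sdprod psi) : a * b = (a.1 * psi a.2 b.1, a.2 * b.2).
Proof. by []. Qed.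

End SemidirectProduct.

Section Representations.
Variables (F : fieldType) (n : nat) (Pi : groupType) (N : nsubgroup Pi).
Local Notation G := (GL F n).
Local Notation Gam := (quotT N).

Definition rep := {multiplicative subgT N -> G}.

Definition invariant (rho : rep) (W : {vspace 'cV[F]_n}) : Prop :=
  forall a v, v \in W -> (val (rho a) *m v)%R \in W.

Definition irreducible (rho : rep) : Prop :=
  (0 < n)%N /\
  forall W, invariant rho W -> W = 0%VS \/ W = fullv.

Definition semisimple (rho : rep) : Prop :=
  forall W, invariant rho W -> exists W',
    [/\ invariant rho W', (W + W' = fullv)%VS & (W :&: W' = 0)%VS].

Local Open Scope classical_set_scope.

Definition rep_orbit (rho : rep) : set rep :=
  [set rho' : rep | exists g : G, forall a, rho' a = g * rho a * g^-1].

(* Only the points of the character variety are modelled: the points of the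
   categorical quotient are the orbits of semi-simple representations. *)
Definition Ch : set (set rep) :=
  [set x | exists2 rho, semisimple rho & x = rep_orbit rho].

Definition Ch_irr : set (set rep) :=
  [set x | exists2 rho, irreducible rho & x = rep_orbit rho].

Lemma rep_orbit_refl rho : rep_orbit rho rho.
Proof. by exists 1 => a; rewrite invg1 mulg1 mul1g. Qed.

Lemma rep_orbit_eq rho rho' : rep_orbit rho rho' -> rep_orbit rho' = rep_orbit rho.
Proof.
case=> g e; apply/seteqP; split=> tau [h f].
  by exists (h * g) => a; rewrite f e invgM !mulgA.
by exists (h * g^-1) => a; rewrite f e invgM invgK !mulgA !mulgVK.
Qed.

Lemma irreducible_semisimple rho : irreducible rho -> semisimple rho.
Proof.
move=> [_ irr] W /irr[]->; [exists fullv|exists 0%VS]; split.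
- by move=> *; apply: memvf.
- exact: add0v.
- exact: cap0v.
- by move=> a v; rewrite memv0 => /eqP ->; rewrite mulmx0 mem0v.
- exact: addv0.
- exact: capv0.
Qed.

Lemma Ch_irr_sub : Ch_irr `<=` Ch.
Proof. by move=> _ [rho /irreducible_semisimple ss ->]; exists rho. Qed.

Section Action.
Variables (psi : {multiplicative Gam -> algAut F n}) (gam : qsection N).

(* conj_subg g a is a ^ g = g^-1 * a * g. *)
Definition twist_fun (s : Gam) (rho : rep) : subgT N -> G :=
  fun a => psi s (rho (conj_subg (gam s) a)).

Lemma twistM s rho : {morph twist_fun s rho : a b / a * b}.
Proof. by move=> a b; rewrite /twist_fun conj_subgM gmulfM aut_funM. Qed.
HB.instance Definition _ s rho :=
  isMultiplicative.Build (subgT N) G (twist_fun s rho) (@twistM s rho).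

Definition twist (s : Gam) (rho : rep) : rep := twist_fun s rho.

(* The action [rho] |-> [twist s rho] (see [Ch_act_orbit]), defined on all
   orbits and not only on the semi-simple ones. *)
Definition Ch_act (s : Gam) (x : set rep) : set rep :=
  \bigcup_(rho in x) rep_orbit (twist s rho).

Lemma Ch_act_orbit s rho : Ch_act s (rep_orbit rho) = rep_orbit (twist s rho).
Proof.
apply/seteqP; split=> [tau [rho' [g e]]|tau o]; last first.
  by exists rho => //; apply: rep_orbit_refl.
rewrite (@rep_orbit_eq (twist s rho)) //; exists (psi s g) => a.
by rewrite /= /twist_fun e !aut_funM aut_funV.
Qed.

Definition Ch_irr_fixed : set (set rep) :=
  [set x | Ch_irr x /\ forall s, Ch_act s x = x].

Definition intertwiner (rho : rep) (h : Gam -> G) : Prop :=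
  forall s a, h s * rho a * (h s)^-1 = twist s rho a.

Definition kcochain (rho : rep) (h : Gam -> G) (s t : Gam) : G :=
  (h (s * t))^-1 * psi s (h t) * h s * rho (defect gam s t).

(* Some value obtained from a representative rho of x and intertwining
   elements h (and 1 if there is none): that all the choices give the same value
   is something to be proved. *)
Definition frakc (x : set rep) : H2 (centerM psi) :=
  xget 1 [set c | exists rho h z,
    [/\ x = rep_orbit rho, intertwiner rho h, represents (kcochain rho h) z &
        c = h2class z]].

Definition frakc_fiber (c : H2 (centerM psi)) : set (set rep) :=
  [set x | Ch_irr_fixed x /\ frakc x = c].

End Action.

Definition admissible (psi : {multiplicative Gam -> algAut F n})
    (rho : {multiplicative Pi -> sdprod psi}) : Prop :=
  forall p, (rho p).2 = qmap N p.

Definition underlies_admissible (psi : {multiplicative Gam -> algAut F n})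
    (rho : rep) : Prop :=
  exists2 r : {multiplicative Pi -> sdprod psi},
    admissible r & forall a : subgT N, (r (val a)).1 = rho a.

End Representations.

Arguments frakc_fiber {F n Pi N} psi gam c.

(* Main.v *)
(* By Schur's lemma the commutant of an irreducible rho is Z_G, so intertwiners
   h_s from rho to its twists are unique up to Z_G; this makes (k_st) a central
   cochain with a class independent of h.

   If psi'_s = ad(x_s) psi_s, then h is an intertwiner for psi iff xh is one for
   psi', and the cochain of xh for psi' is k_st times the cochain
   x_st^-1 x_s psi_s(x_t) representing delta(psi').  On the other hand rho
   extends to an admissible representation into the semi-direct product defined
   by psi' iff some intertwiner for psi' has trivial cochain.  Hence such an
   extension exists iff c([rho]) delta(psi') = 1. *)

Require Import Defs.
From HB Require Import structures.
From mathcomp Require Import all_boot all_order all_algebra.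
From mathcomp Require Import complex.
From mathcomp Require Import boolp classical_sets cardinality reals.

Set Implicit Arguments.
Unset Strict Implicit.
Unset Printing Implicit Defensive.

Local Open Scope group_scope.
Local Open Scope classical_set_scope.

Import GRing.Theory.

Lemma multiplicative1 (A B : groupType) (f : {multiplicative A -> B}) : f 1 = 1.
Proof. by apply: (mulgI (f 1)); rewrite -gmulfM !mulg1. Qed.

(** The only consequence of irreducibility that the later arguments use. *)
Definition central_commutant {F : fieldType} {n : nat} {Pi : groupType}
    {N : nsubgroup Pi} (rho : rep F n N) : Prop :=
  forall g : GL F n, (forall a, g * rho a = rho a * g) -> g \in center F n.

(** * Schur's lemma over an algebraically closed field *)

Section Schur.
Variables (Pi : groupType) (N : nsubgroup Pi) (n : nat).

Lemma closed_eigenvector (F : closedFieldType) (A : 'M[F]_n) :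
  (0 < n)%N -> exists c, exists2 v : 'cV[F]_n, v != 0%R & (A *m v = c *: v)%R.
Proof.
move=> n0.
(* [eigenvalue] concerns row vectors; transposing gives a column eigenvector. *)
have /closed_rootP[c] : size (char_poly A^T%R) != 1%N.
  by rewrite size_char_poly eqSS -lt0n.
rewrite -eigenvalue_root_char => /eigenvalueP[v Av v0].
exists c, v^T%R; last by rewrite -[A]trmxK -trmx_mul Av linearZ.
by apply: contraNneq v0 => /(congr1 trmx); rewrite trmxK trmx0 => ->.
Qed.

(** An eigenspace of g is nonzero and, since g commutes with rho, invariant; so it is the whole
    space and g is scalar. *)
Lemma irreducible_central_commutant (F : closedFieldType) (rho : rep F n N) :
  irreducible rho -> central_commutant rho.
Proof.
case=> n0 irr g cg; have [c [v v0 gv]] := closed_eigenvector (val g) n0.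
pose f := linfun (mulmx (val g - c%:M)%R : 'cV[F]_n -> 'cV[F]_n).
have fE (u : 'cV[F]_n) : (u \in lker f) = (val g *m u == c *: u)%R.
  by rewrite memv_ker lfunE /= mulmxBl mul_scalar_mx subr_eq0.
have finv : Defs.invariant rho (lker f).
  move=> a u; rewrite !fE => /eqP gu; have /(congr1 val) /= ga := cg a.
  by rewrite mulmxA ga -mulmxA gu scalemxAr.
have [k0|kT] := irr _ finv.
  by case/eqP: v0; apply/eqP; rewrite -memv0 -k0 fE gv.
have gE : (val g = c%:M)%R.
  apply/matrixP => i j.
  have : (delta_mx j 0 : 'cV[F]_n)%R \in lker f by rewrite kT memvf.
  rewrite fE => /eqP; rewrite -mul_scalar_mx -!colE => /colP/(_ i).
  by rewrite !mxE.
apply/centerP => x; apply: val_inj.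
by rewrite /= gE mul_scalar_mx mul_mx_scalar.
Qed.

End Schur.

(** * The obstruction cocycle for a fixed psi *)

Section Obstruction.
Variables (F : fieldType) (n : nat) (Pi : groupType) (N : nsubgroup Pi).
Variables (psi : {multiplicative quotT N -> algAut F n}) (gam : qsection N).
Local Notation G := (GL F n).
Local Notation Z := (center F n).
Local Notation Gam := (quotT N).
Implicit Types (rho : rep F n N) (h : Gam -> G).

Lemma central_commutant_conj rho rho' :
  rep_orbit rho rho' -> central_commutant rho -> central_commutant rho'.
Proof.
case=> q qE crho g cg.
have /centerP c : q^-1 * g * q \in Z.
  apply: crho => a; have := cg a; rewrite qE => e.
  apply: (mulgI q); apply: (mulIg q^-1).
  by move: e; rewrite !mulgA !mulgV !mul1g !(mulgK, mulgVK).
apply/centerP => x; apply: (mulgI q^-1); apply: (mulIg q).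
have := c (q^-1 * x * q).
by rewrite !mulgA !mulgK.
Qed.

(** The intertwining relation at gam_s a gam_s^-1, in the form that moves [h s] to the left. *)
Lemma intertwiner_push {rho h} : intertwiner psi gam rho h ->
  forall s a, psi s (rho a) * h s = h s * rho (conj_subg (gam s)^-1 a).
Proof.
move=> hP s a; rewrite -[RHS](mulgVK (h s)) hP /= /twist_fun.
congr (psi s (rho _) * _); apply: val_inj => /=.
by rewrite -conjgM mulVg conjg1.
Qed.

Lemma kcochainE rho h s t :
  psi s (h t) * h s * rho (defect gam s t) =
    h (s * t) * kcochain psi gam rho h s t.
Proof. by rewrite /kcochain !mulgA mulgV mul1g. Qed.

(** With d the defect, gam_s gam_t = d_st gam_st, so conjugations by gam_s gam_t and by gam_st
    differ by d_st. *)
Lemma conj_defect s t a :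
  conj_subg (gam s)^-1 (conj_subg (gam t)^-1 (conj_subg (gam (s * t)) a)) *
    defect gam s t = defect gam s t * a.
Proof.
apply: val_inj; rewrite !subgM /= !conjgE !invgK !mulgA.
by rewrite !(mulgK, mulgVK).
Qed.

(** Associativity of gam_s gam_t gam_u, read off in the subgroup. *)
Lemma defect_cocycle s t u :
  conj_subg (gam s)^-1 (defect gam t u) * defect gam s (t * u) =
    defect gam s t * defect gam (s * t) u.
Proof.
apply: val_inj; rewrite !subgM /= !conjgE !invgK !mulgA.
by rewrite !(mulgK, mulgVK).
Qed.

(* Both [h (s * t)] and [psi s (h t) * h s * rho (defect s t)] intertwine rho
   with its twist by s * t, so their quotient commutes with rho. *)
Lemma kcochain_center rho h s t :
  central_commutant rho -> intertwiner psi gam rho h ->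
  kcochain psi gam rho h s t \in Z.
Proof.
move=> crho hP; apply: crho => a; apply: (mulgI (h (s * t))).
rewrite mulgA -kcochainE -[LHS]mulgA -gmulfM -conj_defect gmulfM.
set b := conj_subg (gam (s * t)) a.
have -> : h (s * t) * (rho a * kcochain psi gam rho h s t) =
    psi (s * t) (rho b) * (h (s * t) * kcochain psi gam rho h s t).
  have := hP (s * t) a; rewrite /= /twist_fun -/b => <-.
  by rewrite !mulgA mulgVK.
rewrite -kcochainE psiM !mulgA; congr (_ * _).
rewrite -aut_funM (intertwiner_push hP) aut_funM -!mulgA.
by rewrite (intertwiner_push hP).
Qed.

(** Multiplied on the left by h_stu, both sides become psi_st(h_u) psi_s(h_t) h_s times rho of a
    side of [defect_cocycle]. *)
Lemma kcochain_cocycle rho h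
    (crho : central_commutant rho) (hP : intertwiner psi gam rho h) :
  cocycle2 (M := centerM psi) (fun s t =>
    exist (fun z => z \in Z) _ (@kcochain_center rho h s t crho hP)).
Proof.
move=> s t u; apply: val_inj.
set k := kcochain psi gam rho h.
change (psi s (k t u) * k s (t * u) = k (s * t) u * k s t).
have kE a b : psi a (h b) * h a * rho (defect gam a b) = h (a * b) * k a b.
  exact: kcochainE.
have kZ a b : k a b \in Z by apply: kcochain_center.
clearbody k; have /centerP kst := kZ s t.
have /centerP ktu := aut_center (psi s) (kZ t u).
apply: (mulgI (h (s * (t * u)))); rewrite ktu mulgA -kE.
(* Centrality brings psi_s(k_tu) next to psi_s(h_tu), so that [kE] applies under psi_s. *)
have -> : psi s (h (t * u)) * h s * rho (defect gam s (t * u)) * psi s (k t u) =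
    psi s (h (t * u) * k t u) * (h s * rho (defect gam s (t * u))).
  by rewrite -mulgA -ktu aut_funM !mulgA -(mulgA (psi s (h _))) -ktu !mulgA.
rewrite -kE !aut_funM -!mulgA (mulgA (psi s (rho _))).
rewrite (intertwiner_push hP) -!mulgA -gmulfM defect_cocycle gmulfM.
rewrite -psiM (mulgA s t u) [in RHS]mulgA -kE -[RHS]mulgA -kst !mulgA.
by rewrite -2!(mulgA (psi (s * t) (h u))) kE !mulgA.
Qed.

Lemma kcochain_representable rho h :
  central_commutant rho -> intertwiner psi gam rho h ->
  exists z : Z2 (centerM psi), represents (kcochain psi gam rho h) z.
Proof.
by move=> crho hP; exists (Z2_mk (kcochain_cocycle crho hP)).
Qed.

(** * Independence of the class from the choices *)

Lemma kcochain_mulZ rho h (c : Gam -> subgT Z) s t :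
  kcochain psi gam rho (fun s => h s * val (c s)) s t =
  kcochain psi gam rho h s t *
    (psi s (val (c t)) * (val (c (s * t)))^-1 * val (c s)).
Proof.
rewrite /kcochain aut_funM invgM.
have /centerP c1 := aut_center (psi s) (valP (c t)).
have /centerP c2 := nsV (valP (c (s * t))).
have /centerP c3 := valP (c s).
by rewrite -!mulgA c2 c1 -!mulgA c3 -!mulgA.
Qed.

Lemma intertwiner_mulZ rho h (c : Gam -> subgT Z) :
  intertwiner psi gam rho h ->
  intertwiner psi gam rho (fun s => h s * val (c s)).
Proof.
move=> hP s a; rewrite -hP invgM !mulgA; congr (_ * _).
by have /centerP cc := valP (c s); rewrite -(mulgA (h s)) cc mulgA mulgK.
Qed.

(** Since h_s and h'_s intertwine rho with the same twist, they differ by a central c_s, and by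
    [kcochain_mulZ] the cochains differ by the coboundary of c. *)
Lemma kcochain_class_indep rho h h' (z z' : Z2 (centerM psi)) :
  central_commutant rho ->
  intertwiner psi gam rho h -> intertwiner psi gam rho h' ->
  represents (kcochain psi gam rho h) z ->
  represents (kcochain psi gam rho h') z' -> h2class z = h2class z'.
Proof.
move=> crho hP hP' zP zP'.
have cZ s : (h s)^-1 * h' s \in Z.
  apply: crho => a; apply: (mulgI (h s)); apply: (mulIg (h' s)^-1).
  by rewrite !mulgA mulgV mul1g mulgK hP' hP.
pose c s : subgT Z := exist (fun z => z \in Z) _ (cZ s).
have h'E : h' = fun s => h s * val (c s).
  by apply/funext => s; rewrite /= mulgA mulgV mul1g.
apply/qmapP/asboolP; exists (c : Gam -> centerM psi) => s t; apply: val_inj.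
change ((val (val z s t))^-1 * val (val z' s t) =
  psi s (val (c t)) * (val (c (s * t)))^-1 * val (c s)).
by rewrite zP zP' h'E kcochain_mulZ mulgA mulVg mul1g.
Qed.

(** If rho' is rho conjugated by g, then psi_s(g) h_s g^-1 intertwines rho'. *)
Lemma kcochain_conj rho rho' h :
  rep_orbit rho rho' -> intertwiner psi gam rho h ->
  exists2 h', intertwiner psi gam rho' h' &
    exists g, forall s t,
      kcochain psi gam rho' h' s t = g * kcochain psi gam rho h s t * g^-1.
Proof.
case=> g gE hP; exists (fun s => psi s g * h s * g^-1) => [s a|].
  have /= := hP s a; rewrite /twist_fun => e.
  rewrite /= /twist_fun !gE !aut_funM -e aut_funV !invgM invgK !mulgA.
  by rewrite !mulgVK.
exists g => s t; rewrite /kcochain gE !aut_funM -psiM aut_funV !invgM invgK.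
by rewrite !mulgA !mulgVK.
Qed.

Lemma frakcE rho h (z : Z2 (centerM psi)) :
  central_commutant rho -> intertwiner psi gam rho h ->
  represents (kcochain psi gam rho h) z ->
  frakc psi gam (rep_orbit rho) = h2class z.
Proof.
move=> crho hP zP.
pose P (c : H2 (centerM psi)) := exists rho' h' z',
  [/\ rep_orbit rho = rep_orbit rho', intertwiner psi gam rho' h',
      represents (kcochain psi gam rho' h') z' & c = h2class z'].
(* The given data show that the default value 1 of [xget] does not occur; the chosen h' is then
   transported to rho, where conjugation fixes its central cochain. *)
have [|rho' [h' [z' [orb hP' zP']]]] := @xgetPex _ 1 P.
  by exists (h2class z), rho, h, z.
rewrite -/(frakc psi gam _) => ->.
have o' : rep_orbit rho' rho by rewrite -orb; apply: rep_orbit_refl.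
have [h1 hP1 [g kE]] := kcochain_conj o' hP'.
apply: (kcochain_class_indep crho hP1 hP _ zP) => s t.
rewrite zP' kE -zP'; have /centerP c := valP (val z' s t).
by rewrite -c mulgK.
Qed.

(** * Intertwiners and admissible extensions *)

Lemma Ch_irr_fixed_intertwiner rho :
  Ch_irr_fixed psi gam (rep_orbit rho) -> exists h, intertwiner psi gam rho h.
Proof.
move=> [_ fix_rho].
have ex s : exists g : G, forall a, g * rho a * g^-1 = twist psi gam s rho a.
  have : rep_orbit rho (twist psi gam s rho).
    by rewrite -(fix_rho s) Ch_act_orbit; apply: rep_orbit_refl.
  by case=> g gE; exists g.
by have [h hP] := choice ex; exists h.
Qed.

(* If r lifts rho and [y s] is the G-component of [r (gam s)], then [(y s)^-1]
   is the intertwiner; conversely [r (a * gam s) := (rho a * y s, s)]. *)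
Lemma underlies_admissibleP rho :
  underlies_admissible psi rho <->
  exists2 h, intertwiner psi gam rho h &
    forall s t, kcochain psi gam rho h s t = 1.
Proof.
split=> [[r adm rE]|[h hP kE]].
  pose f p := (r p).1.
  have fM p q : f (p * q) = f p * psi (qmap N p) (f q).
    by rewrite /f gmulfM sdprodE /= adm.
  have fN (a : subgT N) p : f (val a * p) = rho a * f p.
    rewrite fM /f rE; have -> : qmap N (val a) = 1.
      by apply/qmapP; rewrite mulg1; apply/nsV/valP.
    by rewrite psi1.
  exists (fun s => (f (gam s))^-1) => [s a|s t].
    rewrite invgK -mulgA -fN /= /twist_fun; apply: (mulgI (f (gam s))).
    rewrite mulgA mulgV mul1g -rE -/(f _).
    have := fM (gam s) (val (conj_subg (gam s) a)); rewrite qsecK => <-.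
    by rewrite /= conjgE mulgA mulgV mul1g.
  rewrite /kcochain invgK aut_funV.
  (* Evaluate f on gam_s gam_t = d_st gam_st in two ways. *)
  have -> : f (gam (s * t)) * (psi s (f (gam t)))^-1 * (f (gam s))^-1 =
      (rho (defect gam s t))^-1.
    rewrite -mulgA -invgM; apply: (mulIg (f (gam s) * psi s (f (gam t)))).
    rewrite mulgVK; apply: (mulgI (rho (defect gam s t))).
    rewrite mulgA mulgV mul1g -fN /= mulgVK.
    by rewrite fM qsecK.
  by rewrite mulVg.
(* Each p factors as an element of N times the section at its coset. *)
have subP p : p * (gam (qmap N p))^-1 \in N.
  by apply/ns_swap/qmapP; rewrite qsecK.
pose sub p : subgT N := exist (fun x => x \in N) _ (subP p).
pose y s := (h s)^-1.
have y_push s a : y s * psi s (rho a) = rho (conj_subg (gam s)^-1 a) * y s.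
  apply: (mulgI (h s)); rewrite !mulgA mulgV mul1g.
  by rewrite -(intertwiner_push hP) mulgK.
(* This is k_st = 1, inverted. *)
have yM s t : y s * psi s (y t) = rho (defect gam s t) * y (s * t).
  have := kcochainE rho h s t; rewrite kE mulg1 => e.
  by rewrite /y -e aut_funV !invgM mulgA mulgV mul1g.
pose f p : sdprod psi := (rho (sub p) * y (qmap N p), qmap N p).
have fM : {morph f : p q / p * q}.
  move=> p q; rewrite sdprodE /f /= qmapM; congr (_, _).
  rewrite aut_funM !mulgA -(mulgA (rho (sub p))) y_push -!mulgA yM.
  rewrite !mulgA -!gmulfM; congr (rho _ * _); apply: val_inj.
  rewrite !subgM /= conjgE invgK qmapM !mulgA.
  by rewrite !(mulgK, mulgVK).
pose r : {multiplicative Pi -> sdprod psi} :=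
  HB.pack f (isMultiplicative.Build Pi (sdprod psi) f fM).
exists r => // a; rewrite /= /f /=.
have e : qmap N (val a) = 1.
  by apply/qmapP; rewrite mulg1; apply/nsV/valP.
(* The normalisation gam_1 = 1 makes the extension restrict to rho itself. *)
have y1 : y 1 = 1.
  apply: (mulgI (y 1)); have := yM 1 1; rewrite psi1 !mulg1 => ->.
  have -> : defect gam 1 1 = 1.
    by apply: val_inj; rewrite /= mulg1 qsec1 mulg1 mulgV.
  by rewrite multiplicative1 mul1g.
rewrite e y1 mulg1; congr (rho _); apply: val_inj.
by rewrite /= e qsec1 invg1 mulg1.
Qed.

End Obstruction.

(** * Passage from psi to psi' = ad(x) psi *)

Section ChangeOfForm.
Variables (F : fieldType) (n : nat) (Pi : groupType) (N : nsubgroup Pi).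
Variables (psi psi' : {multiplicative quotT N -> algAut F n}).
Variables (gam : qsection N) (x : quotT N -> GL F n).
Hypothesis psi'E : forall s, psi' s = ad (x s) * psi s.

Lemma intertwiner_form (rho : rep F n N) h :
  intertwiner psi' gam rho (fun s => x s * h s) <-> intertwiner psi gam rho h.
Proof.
have e s a : twist psi' gam s rho a = x s * twist psi gam s rho a * (x s)^-1.
  by rewrite /= /twist_fun psi'E.
split=> hP s a; last by rewrite e -hP invgM !mulgA.
apply: (mulgI (x s)); apply: (mulIg (x s)^-1).
by rewrite -e -hP invgM !mulgA.
Qed.

(** The ad(x_s) in psi'_s cancels the factor x_s before h_s; what remains of x is the central delta
    cochain, which can be pulled out. *)
Lemma kcochain_form (rho : rep F n N) h s t :
  delta_cochain psi x s t \in center F n ->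
  kcochain psi' gam rho (fun s => x s * h s) s t =
    kcochain psi gam rho h s t * delta_cochain psi x s t.
Proof.
move=> /centerP c; rewrite -c /kcochain psi'E algAutM /= !aut_funM invgM.
by rewrite !mulgA mulgVK c /delta_cochain !mulgA.
Qed.

End ChangeOfForm.

(** * The lifting criterion in terms of the connecting map *)

Section Lifting.
Variables (F : fieldType) (n : nat) (Pi : groupType) (N : nsubgroup Pi).
Variables (psi psi' : {multiplicative quotT N -> algAut F n}).
Variables (gam : qsection N) (rho : rep F n N) (h : quotT N -> GL F n).
Hypotheses (crho : central_commutant rho) (hP : intertwiner psi gam rho h).

Lemma underlies_admissible_delta (e : Omega psi' = Omega psi) :
  underlies_admissible psi' rho <->
  (frakc psi gam (rep_orbit rho))^-1 = delta (form_class e).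
Proof.
pose x s := sval (form_lift e s).
have psi'E s : psi' s = ad (x s) * psi s by apply: (svalP (form_lift e s)).
pose c := @Z1_mk _ (Inn psi) _ (form_cocycle1 e).
have xc : lifts x c by [].
pose d := Z2_mk (delta_cochain_cocycle xc).
have dP : represents (delta_cochain psi x) d by [].
have -> : delta (form_class e) = h2class d by apply: deltaE xc dP.
split=> [/(underlies_admissibleP psi' gam)[w wP wE]|].
  (* Dividing by x gives an intertwiner for psi whose cochain is the inverse of d. *)
  pose h1 s := (x s)^-1 * w s.
  have we : w = fun s => x s * h1 s.
    by apply/funext => s; rewrite /h1 mulgA mulgV mul1g.
  rewrite we in wP wE.
  have hP1 : intertwiner psi gam rho h1 by apply/(intertwiner_form gam psi'E).
  rewrite (@frakcE _ _ _ _ _ _ _ h1 d^-1) ?/h2class ?qmapV ?invgK // => s t.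
  apply: (mulIg (val (val d s t))).
  have <- := kcochain_form gam psi'E rho h1 (delta_cochain_center s t xc).
  by rewrite wE; apply: mulVg.
have [z zP] := kcochain_representable crho hP.
(* Equality of classes only makes z d the coboundary of some b; changing h by b^-1 makes the cochain
   trivial. *)
rewrite (frakcE crho hP zP) /h2class -qmapV => /qmapP.
rewrite invgK => /asboolP[b bE].
pose b' s : subgT (center F n) := (b s : subgT (center F n))^-1.
apply/(underlies_admissibleP psi' gam).
exists (fun s => x s * (h s * val (b' s))) => [|s t].
  by apply/(intertwiner_form gam psi'E); apply: intertwiner_mulZ.
have dZ := delta_cochain_center s t xc.
rewrite (kcochain_form gam psi'E rho _ dZ) kcochain_mulZ.
rewrite -mulgA -(centerP _ dZ) mulgA.
have zd := congr1 val (bE s t).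
pose p : GL F n := psi s (val (b t : subgT (center F n))).
pose q : GL F n := val (b (s * t) : subgT (center F n)).
pose r : GL F n := val (b s : subgT (center F n)).
have /centerP cp : p \in center F n by apply: aut_center; apply: valP.
have /centerP cr : r \in center F n by apply: valP.
rewrite (_ : _ * delta_cochain _ _ _ _ = p * q^-1 * r); last first.
  by rewrite -dP -zP; apply: zd.
rewrite (_ : psi s _ = p^-1); last by rewrite aut_funV.
change (p * q^-1 * r * (p^-1 * (q^-1)^-1 * r^-1) = 1).
rewrite invgK -mulgA cr mulgVK -mulgA cp -!mulgA -cp mulKg.
exact: mulVg.
Qed.

End Lifting.

Theorem theorem1 (R : realType) (n : nat)
    (Pi : groupType) (Pit : nsubgroup Pi)
    (psi : {multiplicative quotT Pit -> algAut R[i] n})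
    (gam : qsection Pit) :
  finitely_generated Pi ->
  finitely_generated (subgT Pit) ->
  finite_set [set: quotT Pit] ->
  (* (i) *)
  ((forall rho : rep R[i] n Pit, Ch_irr_fixed psi gam (rep_orbit rho) ->
      (exists h, intertwiner psi gam rho h) /\
      (forall h, intertwiner psi gam rho h ->
        exists2 z : Z2 (centerM psi),
          represents (kcochain psi gam rho h) z &
          h2class z = frakc psi gam (rep_orbit rho))) /\
   trivIset [set: H2 (centerM psi)] (frakc_fiber psi gam) /\
   \bigcup_c frakc_fiber psi gam c = Ch_irr_fixed psi gam) /\
  (* (ii) *)
  (forall rho : rep R[i] n Pit, Ch_irr_fixed psi gam (rep_orbit rho) ->
    ((exists2 psi' : {multiplicative quotT Pit -> algAut R[i] n},
        Omega psi' = Omega psi & underlies_admissible psi' rho) <->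
     (exists psi' : {multiplicative quotT Pit -> algAut R[i] n},
        exists e : Omega psi' = Omega psi,
          (frakc psi gam (rep_orbit rho))^-1 = delta (form_class e))) /\
    (forall (psi' : {multiplicative quotT Pit -> algAut R[i] n})
        (e : Omega psi' = Omega psi),
      underlies_admissible psi' rho <->
      (frakc psi gam (rep_orbit rho))^-1 = delta (form_class e))).
Proof.
move=> _ _ _.
(* A representative of the orbit is only conjugate to an irreducible rho0, so the property is
   carried along the conjugation. *)
have crho (rho : rep R[i] n Pit) :
    Ch_irr_fixed psi gam (rep_orbit rho) -> central_commutant rho.
  case=> -[rho0 irr orb] _.
  apply: (@central_commutant_conj _ _ _ _ rho0).
    by rewrite -orb; apply: rep_orbit_refl.
  exact: irreducible_central_commutant irr.
split; first split; [|split|].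
- move=> rho fix_rho; split=> [|h hP].
    exact: Ch_irr_fixed_intertwiner.
  have [z zP] := kcochain_representable (crho _ fix_rho) hP.
  by exists z => //; rewrite (frakcE (crho _ fix_rho) hP zP).
(* The pieces are fibres of the function [frakc], hence disjoint. *)
- by move=> c d _ _ [y [[_ <-] [_ <-]]].
- apply/seteqP; split=> [y [c _ []]//|y fix_y].
  by exists (frakc psi gam y).
move=> rho fix_rho; have [h hP] := Ch_irr_fixed_intertwiner fix_rho.
have key := underlies_admissible_delta (crho _ fix_rho) hP.
split; last exact: key.
split=> [[psi' e /(key _ e) ?]|[psi' [e /key ?]]]; first by exists psi', e.
by exists psi'.
Qed.
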